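(* We have $$f_{0000}(x)=1+\frac{x(1-3x+3x^3+11x^4-3x^5-19x^6-9x^7+11x^8+14x^9+11x^{10}+4x^{11}+x^{12})}{(1-x-x^2-x^3)^5}$$ as formal power series in $x$, where $f_{0000}(x)=\sum_{n\ge 0} b_n(0000)x^n$ and $b_n(0000)$ is the number of ascent sequences of length $n$ that avoid both patterns $021$ and $0000$.
   Context: For a finite sequence $w=w_1\cdots w_n$ of integers, $\mathrm{asc}(w)$ is the number of indices $1\le i\le n-1$ with $w_i<w_{i+1}$. An ascent sequence of length $n\ge 1$ is a sequence $a_1\cdots a_n$ of non-negative integers such that $a_1=0$ and $a_i\le \mathrm{asc}(a_1\cdots a_{i-1})+1$ for $1<i\le n$; there is exactly one (empty) ascent sequence of length $0$. A sequence $\pi=\pi_1\cdots\pi_n$ contains a pattern $\tau=\tau_1\cdots\tau_m$ if there are indices $1\le i_1<\cdots<i_m\le n$ such that for all $j,k\in\{1,\dots,m\}$: $\pi_{i_j}<\pi_{i_k}$ iff $\tau_j<\tau_k$, and $\pi_{i_j}=\pi_{i_k}$ iff $\tau_j=\tau_k$; otherwise $\pi$ avoids $\tau$. For a pattern $\tau$, $B_n(\tau)$ is the set of ascent sequences of length $n$ avoiding both $021$ and $\tau$ (with $B_0(\tau)$ consisting of the empty sequence), and $b_n(\tau)=|B_n(\tau)|$. *)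

(* Defs.v *)
From HB Require Import structures.
From mathcomp Require Import all_boot all_order all_algebra.

Set Implicit Arguments.
Unset Strict Implicit.
Unset Printing Implicit Defensive.

Import GRing.Theory.

(* Words are 0-indexed: the letter written w_(i+1) on paper is nth 0 w i. *)

Definition asc (w : seq nat) : nat :=
  #|[set i : 'I_(size w).-1 | nth 0 w i < nth 0 w i.+1]|.

Definition is_ascent_seq (w : seq nat) : bool :=
  [forall i : 'I_(size w),
    if i == 0 :> nat then nth 0 w i == 0
    else nth 0 w i <= asc (take i w) + 1].

Definition contains (w tau : seq nat) : bool :=
  [exists f : {ffun 'I_(size tau) -> 'I_(size w)},
    [forall j : 'I_(size tau), forall k : 'I_(size tau),
      [&& (j < k) ==> (f j < f k),
          (nth 0 w (f j) < nth 0 w (f k)) == (nth 0 tau j < nth 0 tau k)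
        & (nth 0 w (f j) == nth 0 w (f k)) == (nth 0 tau j == nth 0 tau k)]]].

Definition avoids (w tau : seq nat) : bool := ~~ contains w tau.

Definition in_B (tau w : seq nat) : bool :=
  [&& is_ascent_seq w, avoids w [:: 0; 2; 1] & avoids w tau].

(* The letters of an ascent sequence of length n are smaller than n (see
   [ascent_seq_lt]), so B_n(tau) is realised inside the finite type of n-letter
   words over 'I_n; [b_correct] checks that no word is lost. *)
Definition B (tau : seq nat) (n : nat) : {set n.-tuple 'I_n} :=
  [set t : n.-tuple 'I_n | in_B tau (map val t)].

Definition b (tau : seq nat) (n : nat) : nat := #|B tau n|.

Lemma asc_le (w : seq nat) : asc w <= (size w).-1.
Proof. by rewrite /asc (leq_trans (max_card _)) // card_ord. Qed.

Lemma ascent_seq_lt (w : seq nat) (x : nat) :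
  is_ascent_seq w -> x \in w -> x < size w.
Proof.
move=> /forallP asw /(nthP 0) [i lti <-].
have := asw (Ordinal lti) => /=; case: i lti => [|i] lti /=.
  by move=> /eqP ->.
move=> /leq_ltn_trans; apply; apply: leq_ltn_trans (lti).
by rewrite addn1 ltnS (leq_trans (asc_le _)) // size_take lti.
Qed.

Lemma b_correct (tau : seq nat) (n : nat) (s : seq (seq nat)) :
  uniq s -> (forall w, (w \in s) = (size w == n) && in_B tau w) ->
  b tau n = size s.
Proof.
move=> us sP.
have inj : injective (fun t : n.-tuple 'I_n => map val t).
  by move=> t u /(inj_map val_inj) /val_inj.
rewrite /b cardE -(size_map (fun t : n.-tuple 'I_n => map val t)).
apply/perm_size/uniq_perm => // [|w]; first by rewrite map_inj_uniq ?enum_uniq.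
rewrite sP; apply/mapP/andP => [[t]|[/eqP sw Bw]].
  by rewrite mem_enum inE => Bt ->; rewrite size_map size_tuple.
have ltw x : x \in w -> x < n.
  by rewrite -sw; apply: ascent_seq_lt; case/and3P: Bw.
have st : size (pmap (insub : nat -> option 'I_n) w) == n.
  rewrite size_pmap_sub -[X in _ == X]sw -all_count.
  by apply/allP => x /ltw.
have wE : w = map val (Tuple st).
  rewrite /= (pmap_filter (insubK _)); symmetry; apply/all_filterP/allP=> x xw.
  by rewrite /= insubT //; exact: ltw.
by exists (Tuple st) => //; rewrite mem_enum inE -wE.
Qed.

Local Open Scope ring_scope.

(* A formal power series is its sequence of coefficients; two series are equal
   when all their coefficients agree, i.e. when they are related by =1. *)
Definition fps (R : Type) : Type := nat -> R.

Definition fps_of_poly (R : nzRingType) (p : {poly R}) : fps R := fun n => p`_n.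

Definition fps_add (R : nzRingType) (f g : fps R) : fps R :=
  fun n => f n + g n.

Definition fps_mul (R : nzRingType) (f g : fps R) : fps R :=
  fun n => \sum_(i < n.+1) f i * g (n - i)%N.

(* The multiplicative inverse h of g, when g 0 is a unit, is given by
   h 0 = 1 / g 0 and h n.+1 = - (g 1 * h n + ... + g n.+1 * h 0) / g 0;
   [fps_inv_seq g n] lists h 0, ..., h n. *)
Fixpoint fps_inv_seq (R : comUnitRingType) (g : fps R) (n : nat) : seq R :=
  if n is m.+1 then
    let s := fps_inv_seq g m in
    rcons s (- (g 0%N)^-1 * \sum_(i < m.+1) g i.+1 * s`_(m - i))
  else [:: (g 0%N)^-1].

Definition fps_inv (R : comUnitRingType) (g : fps R) : fps R :=
  fun n => (fps_inv_seq g n)`_n.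

Definition fps_div (R : comUnitRingType) (f g : fps R) : fps R :=
  fps_mul f (fps_inv g).

Lemma size_fps_inv_seq (R : comUnitRingType) (g : fps R) (n : nat) :
  size (fps_inv_seq g n) = n.+1.
Proof. by elim: n => //= n IHn; rewrite size_rcons IHn. Qed.

Lemma nth_fps_inv_seq (R : comUnitRingType) (g : fps R) (n k : nat) :
  (k <= n)%N -> (fps_inv_seq g n)`_k = fps_inv g k.
Proof.
elim: n => [|n IHn]; first by rewrite leqn0 => /eqP ->.
rewrite leq_eqVlt => /predU1P[-> //|lekn].
by rewrite /= nth_rcons size_fps_inv_seq lekn IHn.
Qed.

Lemma fps_mulfV (R : comUnitRingType) (g : fps R) :
  g 0%N \is a GRing.unit -> fps_mul g (fps_inv g) =1 fps_of_poly 1.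
Proof.
move=> ug [|n]; rewrite /fps_mul /fps_of_poly coef1.
  by rewrite big_ord1 /= mulrV.
rewrite big_ord_recl /= subn0 /fps_inv /= nth_rcons size_fps_inv_seq.
rewrite ltnn eqxx mulNr mulrN mulrA mulrV // mul1r.
apply/eqP; rewrite addrC subr_eq0; apply/eqP/eq_bigr => i _.
by rewrite /= /bump /= add1n subSS (@nth_fps_inv_seq _ _ n) ?leq_subr.
Qed.

Definition f_ogf (tau : seq nat) : fps int := fun n => (b tau n)%:Z.

(* Main.v *)
(** Avoiding 021 means that the nonzero letters weakly increase, and avoiding
    0000 that no letter occurs more than three times.  Hence the letters that
    may be appended to such an ascent sequence depend only on a bounded state:
    the number of zeros, the multiplicity of the maximum, whether the last
    letter is 0, and the difference between the number of ascents and the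
    maximum.  This gives a finite automaton with numbers of paths [p_n(s)].
    For each state [s], the coefficients of [(1-x-x^2-x^3)^5 sum_n p_n(s) x^n]
    obey the recursion [r_(n+1)(s) = d_(n+1) + sum_t r_n(t)] over the successors
    [t] of [s], where [d] lists the coefficients of the fifth power; as [d] stops
    at degree 15, once [r_15] vanishes at every state so do all later [r_n]. *)

Require Import Defs.
From mathcomp Require Import all_boot all_order all_algebra.
From mathcomp Require Import zify ring.

Set Implicit Arguments.
Unset Strict Implicit.
Unset Printing Implicit Defensive.

Import GRing.Theory.

(** * Pattern containment in terms of subsequences *)

Lemma containsP (w tau : seq nat) :
  reflect (exists s, [/\ subseq s w, size s = size tau
    & forall j k, j < size tau -> k < size tau ->
      (nth 0 s j < nth 0 s k) = (nth 0 tau j < nth 0 tau k) /\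
      (nth 0 s j == nth 0 s k) = (nth 0 tau j == nth 0 tau k)])
  (contains w tau).
Proof.
apply: (iffP existsP) => [[f /forallP fP]|[s [sub_sw sz_s isoP]]].
- pose idx := [seq val (f j) | j <- enum 'I_(size tau)].
  have sz_idx : size idx = size tau by rewrite size_map size_enum_ord.
  have nth_idx (j : 'I_(size tau)) : nth 0 idx j = f j.
    by rewrite (nth_map j) ?size_enum_ord // nth_ord_enum.
  have srt_idx : sorted ltn idx.
    rewrite sorted_pairwise; last exact: ltn_trans.
    apply/(pairwiseP 0) => j k; rewrite !inE sz_idx => ltj ltk ltjk.
    rewrite (nth_idx (Ordinal ltj)) (nth_idx (Ordinal ltk)).
    by have /forallP/(_ (Ordinal ltk))/and3P[/implyP/(_ ltjk)] := fP (Ordinal ltj).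
  (* A strictly increasing list of positions is the filter of [iota] by membership in it, hence a
     subsequence of [iota]. *)
  have sub_idx : subseq idx (iota 0 (size w)).
    have -> : idx = filter (mem idx) (iota 0 (size w)).
      apply: (irr_sorted_eq ltn_trans ltnn) => //.
        exact: sorted_filter ltn_trans _ _ (iota_ltn_sorted _ _).
      move=> i; rewrite mem_filter mem_iota add0n inE /=.
      by case: mapP => // -[j _ ->]; rewrite ltn_ord.
    exact: filter_subseq.
  exists (map (nth 0 w) idx); split.
  + by rewrite -{2}[w](mkseq_nth 0) map_subseq.
  + by rewrite size_map.
  move=> j k ltj ltk.
  rewrite !(nth_map 0) ?sz_idx //.
  rewrite (nth_idx (Ordinal ltj)) (nth_idx (Ordinal ltk)).
  by have /forallP/(_ (Ordinal ltk))/and3P[_ /eqP -> /eqP ->] := fP (Ordinal ltj).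
have /subseqP[m sz_m def_s] := sub_sw.
pose idx := mask m (iota 0 (size w)).
have s_idx : s = map (nth 0 w) idx.
  by rewrite map_mask -/(mkseq _ _) mkseq_nth.
have sz_idx : size idx = size tau by rewrite -sz_s s_idx size_map.
have srt_idx : pairwise ltn idx.
  rewrite -sorted_pairwise; last exact: ltn_trans.
  exact: sorted_mask ltn_trans _ _ (iota_ltn_sorted _ _).
have idx_lt (j : 'I_(size tau)) : nth 0 idx j < size w.
  have: nth 0 idx j \in idx by rewrite mem_nth ?sz_idx.
  by move/mem_mask; rewrite mem_iota.
exists [ffun j => Ordinal (idx_lt j)]; apply/forallP=> j; apply/forallP=> k.
rewrite !ffunE /=.
have nth_s (i : 'I_(size tau)) : nth 0 w (nth 0 idx i) = nth 0 s i.
  by rewrite s_idx (nth_map 0) ?sz_idx.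
rewrite !nth_s; have [-> ->] := isoP j k (ltn_ord j) (ltn_ord k).
rewrite !eqxx !andbT; apply/implyP=> ltjk.
by move/(pairwiseP 0): srt_idx; apply; rewrite ?inE ?sz_idx.
Qed.

Lemma contains0000 (w : seq nat) :
  contains w [:: 0; 0; 0; 0] = has (fun x => 3 < count_mem x w) w.
Proof.
apply/containsP/hasP => [[s [sub_sw sz_s isoP]]|[x _ cnt_x]].
  case: s sz_s sub_sw isoP => [|a [|b [|c [|d [|]]]]] //= _ sub_sw isoP.
  have [_ /eqP ab] := isoP 0 1 isT isT; have [_ /eqP ac] := isoP 0 2 isT isT.
  have [_ /eqP ad] := isoP 0 3 isT isT; move: ab ac ad sub_sw => /= <- <- <- sub.
  exists a; first by apply: (mem_subseq sub); rewrite mem_head.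
  by have := leq_count_subseq (pred1 a) sub; rewrite /= eqxx.
exists (nseq 4 x); split => //.
  apply: subseq_trans (filter_subseq (pred1 x) w).
  have /all_pred1P -> : all (pred1 x) (filter (pred1 x) w) by exact: filter_all.
  rewrite size_filter -(subnKC cnt_x) nseqD; exact: prefix_subseq.
by move=> [|[|[|[|j]]]] [|[|[|[|k]]]] //= _ _; rewrite ltnn eqxx.
Qed.

(** Here [y] stands before [x]: a later zero is always harmless, since the 1 of a 021 is
    positive. *)
Definition compat (y x : nat) : bool := (x == 0) || (y <= x).

Lemma pairwiseN_subseq (T : eqType) (r : rel T) (s : seq T) :
  ~~ pairwise r s -> exists x y, subseq [:: x; y] s /\ ~~ r x y.
Proof.
elim: s => //= x s IHs; rewrite negb_and => /orP[/allPn[y ys nrxy]|/IHs].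
  by exists x, y; rewrite eqxx sub1seq.
case=> y [z [sub nr]]; exists y, z; split=> //.
exact: subseq_trans sub (subseq_cons s x).
Qed.

(** The leading 0 can serve as the 0 of a 021, so an occurrence amounts to a pair [y] before [x]
    with [0 < x < y]. *)
Lemma contains021 (w : seq nat) :
  contains (0 :: w) [:: 0; 2; 1] = ~~ pairwise compat (0 :: w).
Proof.
apply/containsP/idP => [[s [sub_sw sz_s isoP]]|].
  apply/negP => /(subseq_pairwise sub_sw).
  case: s sz_s {sub_sw} isoP => [|a [|b [|c [|]]]] //= _ isoP.
  have [/= ac _] := isoP 0 2 isT isT; have [/= cb _] := isoP 2 1 isT isT.
  by rewrite /compat; lia.
rewrite /= negb_and => /orP[/allPn[x _]|]; first by rewrite /compat orbT.
case/pairwiseN_subseq=> y [x [sub]]; rewrite /compat negb_or => /andP[x0 ltxy].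
exists [:: 0; y; x]; split=> //.
by move=> [|[|[|j]]] [|[|[|k]]] //= _ _; lia.
Qed.

(** * Appending a letter: ascents, validity, maximum *)

Lemma ascE (w : seq nat) :
  asc w = \sum_(0 <= i < (size w).-1) (nth 0 w i < nth 0 w i.+1).
Proof.
by rewrite /asc -sum1dep_card big_mkord big_mkcond; apply: eq_bigr => i _; case: ifP.
Qed.

Lemma asc_rcons (w : seq nat) (x : nat) :
  w != [::] -> asc (rcons w x) = asc w + (last 0 w < x).
Proof.
case: w => // y w _; rewrite !ascE size_rcons /= big_nat_recr //=; congr addn.
  rewrite !big_mkord; apply: eq_bigr => i _.
  by rewrite -rcons_cons !nth_rcons /= !ltnS ltn_ord (ltnW (ltn_ord i)).
by rewrite -rcons_cons !nth_rcons /= ltnSn ltnn eqxx nth_last.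
Qed.

(** The bound on each letter involves only the prefix before it, which an appended letter leaves
    unchanged. *)
Lemma is_ascent_seq_rcons (w : seq nat) (x : nat) :
  is_ascent_seq (rcons w x) =
  is_ascent_seq w && (if w == [::] then x == 0 else x <= asc w + 1).
Proof.
have last_ok : (if size w == 0 then x == 0 else x <= asc w + 1) =
    (if w == [::] then x == 0 else x <= asc w + 1) by case: w.
rewrite -{}last_ok; apply/forallP/andP => [ascP|[/forallP ascP lastP] [i /=]].
  split; last first.
    have lt : size w < size (rcons w x) by rewrite size_rcons.
    by have := ascP (Ordinal lt); rewrite /= nth_rcons ltnn eqxx -cats1 take_size_cat.
  apply/forallP=> i.
  have lt : i < size (rcons w x) by rewrite size_rcons ltnW // ltnS.
  have := ascP (Ordinal lt).
  by rewrite /= nth_rcons ltn_ord -cats1 takel_cat // ltnW.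
rewrite size_rcons ltnS leq_eqVlt => /predU1P[->|lt].
  by rewrite nth_rcons ltnn eqxx -cats1 take_size_cat.
have := ascP (Ordinal lt).
by rewrite /= nth_rcons lt -cats1 takel_cat // ltnW.
Qed.

Definition valid (w : seq nat) : bool :=
  [&& is_ascent_seq w, pairwise compat w & all (fun x => count_mem x w <= 3) w].

Lemma in_B0000E (w : seq nat) : in_B [:: 0; 0; 0; 0] w = valid w.
Proof.
rewrite /in_B /valid /avoids contains0000 -all_predC.
have -> : all (predC (fun x => 3 < count_mem x w)) w =
          all (fun x => count_mem x w <= 3) w.
  by apply: eq_all => x /=; rewrite -leqNgt.
case asc_w: (is_ascent_seq w) => //=; congr andb.
(* [contains021] wants a leading 0; the ascent condition supplies it unless the word is empty. *)
case: w asc_w => [_|y w /forallP/(_ ord0)/= /eqP ->].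
  by rewrite /=; apply/negP=> /containsP[s []]; rewrite subseq0 => /eqP ->.
by rewrite contains021 negbK.
Qed.

Definition top (w : seq nat) : nat := \max_(x <- w) x.

Lemma top_rcons (w : seq nat) (x : nat) : top (rcons w x) = maxn (top w) x.
Proof. by rewrite /top big_rcons. Qed.

Lemma leq_top (w : seq nat) (x : nat) : x \in w -> x <= top w.
Proof. by move=> xw; exact: (@leq_bigmax_seq _ w xpredT id x). Qed.

Lemma all_compat (w : seq nat) (x : nat) :
  all (compat^~ x) w = (x == 0) || (top w <= x).
Proof.
apply/allP/orP => [cx|cx y /leq_top lt_y]; last by rewrite /compat; lia.
case: eqP => [|/eqP x0]; [by left|right].
apply/bigmax_leqP_seq => y yw _; have := cx y yw.
by rewrite /compat (negPf x0).
Qed.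

Lemma count_mem_rcons (w : seq nat) (x y : nat) :
  count_mem y (rcons w x) = count_mem y w + (x == y).
Proof. by rewrite -cats1 count_cat /= addn0. Qed.

Lemma count_gt_top (w : seq nat) (x : nat) : top w < x -> count_mem x w = 0.
Proof. by move=> lt; apply/count_memPn/negP => /leq_top; rewrite leqNgt lt. Qed.

Lemma all_countP (k : nat) (w : seq nat) :
  reflect (forall x, count_mem x w <= k) (all (fun x => count_mem x w <= k) w).
Proof.
apply: (iffP allP) => [cw x|cw x _] //.
by case xw: (x \in w); [exact: cw | rewrite (count_memPn _) ?xw].
Qed.

Lemma valid_rcons (w : seq nat) (x : nat) : w != [::] ->
  valid (rcons w x) = [&& valid w, x <= asc w + 1,
                          (x == 0) || (top w <= x) & count_mem x w < 3].
Proof.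
move=> w0; rewrite /valid is_ascent_seq_rcons (negPf w0) pairwise_rcons all_compat.
have -> : all (fun y => count_mem y (rcons w x) <= 3) (rcons w x) =
    all (fun y => count_mem y w <= 3) w && (count_mem x w < 3).
  apply/all_countP/andP => [cw|[/all_countP cw cx] y].
    split; first by apply/all_countP=> y; have := cw y; rewrite count_mem_rcons; lia.
    by have := cw x; rewrite count_mem_rcons eqxx addn1.
  rewrite count_mem_rcons; have := cw y; case: eqP => [<-|_]; lia.
rewrite -!andbA; case: (is_ascent_seq w); rewrite //=.
by case: (pairwise compat w); case: (all _ w); rewrite ?(andbT, andbF) //=.
Qed.

Lemma valid1 (x : nat) : valid [:: x] = (x == 0).
Proof.
rewrite /valid -[[:: x]]/(rcons [::] x) is_ascent_seq_rcons /=.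
rewrite eqxx /= !andbT; case: (x == 0); rewrite ?andbF ?andbT //.
by apply/forallP => -[].
Qed.

(** A new maximum is at most [asc w + 1] and, exceeding the last letter, creates an ascent, so the
    bound persists. A nonzero letter may not lie below the maximum, so it becomes the maximum. *)
Lemma valid_top_asc (w : seq nat) :
  valid w -> w != [::] ->
  top w <= asc w /\ (last 0 w = 0 \/ last 0 w = top w).
Proof.
elim/last_ind: w => // w x IHw; have [-> | w0] := eqVneq w [::].
  by rewrite valid1 => /eqP -> _; rewrite /top /= big_seq1; split=> //; left.
rewrite valid_rcons // => /and4P[/IHw/(_ w0)[le_top lastw] lex cx _] _.
rewrite last_rcons top_rcons asc_rcons //; move: lastw lex cx le_top; lia.
Qed.

(** * The automaton of bounded states *)

(* (number of zeros, multiplicity of the maximum, last letter is 0,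
   [asc w - top w]); the multiplicity is set to 0 when the word has only zeros,
   and the subtraction never truncates by [valid_top_asc]. *)
Definition state : Type := (nat * nat * bool * nat)%type.

Definition state_of (w : seq nat) : state :=
  (count_mem 0 w, if top w == 0 then 0 else count_mem (top w) w,
   last 0 w == 0, asc w - top w).

(** Three blocks: a zero, a repeated maximum, a new maximum up to [asc w + 1]. The guard [0 < top w]
    keeps 0 from being listed twice. *)
Definition letters (w : seq nat) : seq nat :=
  (if count_mem 0 w < 3 then [:: 0] else [::]) ++
  (if (0 < top w) && (count_mem (top w) w < 3) then [:: top w] else [::]) ++
  iota (top w).+1 (asc w - top w).+1.

(** Repeating the maximum gains an ascent exactly when the last letter is 0, whence [d + l]. A new
    maximum [top w + 1 + k] adds one ascent and raises the maximum by [k + 1], whence [d - k]. *)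
Definition succ (s : state) : seq state :=
  let: (z, c, l, d) := s in
  (if z < 3 then [:: (z.+1, c, true, d)] else [::]) ++
  (if (0 < c) && (c < 3) then [:: (z, c.+1, false, d + l)] else [::]) ++
  [seq (z, 1, false, d - k) | k <- iota 0 d.+1].

Lemma uniq_letters (w : seq nat) : uniq (letters w).
Proof.
by rewrite /letters; do 2!case: ifP => ?; rewrite /= ?iota_uniq ?inE ?mem_iota; lia.
Qed.

Lemma mem_letters (w : seq nat) (x : nat) : valid w -> w != [::] ->
  (x \in letters w) = valid (rcons w x).
Proof.
move=> vw w0; have [le_top _] := valid_top_asc vw w0.
rewrite valid_rcons // vw /letters !mem_cat mem_iota.
have [-> | x0] /= := eqVneq x 0.
  by case: ifP => c0; rewrite ?inE //=; case: ifP => tp; rewrite ?inE //; lia.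
rewrite [x \in _](_ : _ = false); last by case: ifP; rewrite ?inE // (negPf x0).
case: (ltngtP (top w) x) x0 => [lt|lt|<-] x0 /=.
- by rewrite (count_gt_top lt); case: ifP; rewrite ?inE //=; lia.
- by case: ifP; rewrite ?inE //=; lia.
- by case: ifP; rewrite ?inE //=; lia.
Qed.

(** An equality of lists, block by block, so that multiplicities survive when words are counted by
    paths. *)
Lemma state_of_letters (w : seq nat) : valid w -> w != [::] ->
  [seq state_of (rcons w x) | x <- letters w] = succ (state_of w).
Proof.
move=> vw w0; have [le_top lastw] := valid_top_asc vw w0.
(* The maximum is attained, so the guard [0 < top w] of [letters] agrees with the guard [0 < c] of
   [succ]. *)
have topw : 0 < top w -> 0 < count_mem (top w) w.
  move=> top0; rewrite -has_count has_pred1.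
  have [y yw ->] : exists2 y, y \in w & top w = y.
    rewrite /top; elim: (w) w0 => // y v IHv _; rewrite big_cons.
    have [-> | v0] := eqVneq v [::]; first by exists y; rewrite ?inE // big_nil maxn0.
    have [z zv ->] := IHv v0; case: (leqP y z) => _; last by exists y; rewrite ?mem_head.
    by exists z; rewrite // inE zv orbT.
  by [].
rewrite /letters /succ /state_of !map_cat; congr (_ ++ (_ ++ _)).
- case: ifP => // _ /=; rewrite top_rcons maxn0 last_rcons asc_rcons // ltn0 addn0.
  rewrite !count_mem_rcons eqxx addn1; congr [:: (_, _, _, _)].
  by case: eqP => // /eqP top0; rewrite eq_sym (negPf top0) addn0.
- have [-> // | top0] := eqVneq (top w) 0.
  rewrite lt0n top0 topw ?lt0n //=; case: ifP => // _ /=.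
  rewrite top_rcons maxnn last_rcons asc_rcons // !count_mem_rcons eqxx.
  rewrite (negPf top0) addn0 addn1; congr [:: (_, _, _, _)].
  by move: top0 lastw le_top; lia.
rewrite -[(top w).+1]addn0 iotaDl -map_comp; apply/eq_in_map => k.
rewrite mem_iota /= => ltk; rewrite top_rcons last_rcons asc_rcons //.
rewrite !count_mem_rcons (maxn_idPr _); last by lia.
rewrite (@count_gt_top w ((top w).+1 + k)) ?eqxx; last by lia.
rewrite addSn /= addn0; congr (_, _, _, _); move: lastw le_top ltk; lia.
Qed.

(** * Counting words by paths *)

(** Index [n] stands for length [n.+1]: the automaton starts at the one-letter word 0. *)
Fixpoint words (n : nat) : seq (seq nat) :=
  if n is m.+1 then [seq rcons w x | w <- words m, x <- letters w]
  else [:: [:: 0]].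

Lemma mem_words (n : nat) (w : seq nat) :
  (w \in words n) = (size w == n.+1) && valid w.
Proof.
elim: n w => [|n IHn] w.
  rewrite inE; case: w => [|x [|y w]] //; last by rewrite eqseq_cons andbF.
  by rewrite valid1 eqseq_cons andbT.
apply/allpairsPdep/andP => [[v [x [vn xv ->]]]|[sz_w]].
  move: vn; rewrite IHn => /andP[/eqP sz_v vv].
  have v0 : v != [::] by rewrite -size_eq0 sz_v.
  by rewrite size_rcons sz_v -mem_letters.
case/lastP: w sz_w => // w x; rewrite size_rcons eqSS => sz_w vwx.
have w0 : w != [::] by rewrite -size_eq0 (eqP sz_w).
have vw : valid w by move: vwx; rewrite valid_rcons // => /andP[].
by exists w, x; rewrite IHn sz_w vw mem_letters.
Qed.

Lemma uniq_words (n : nat) : uniq (words n).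
Proof.
elim: n => //= n IHn; apply: allpairs_uniq_dep => //.
  by move=> w _; exact: uniq_letters.
by move=> [w x] [v y] _ _ /= /rcons_inj[<- <-].
Qed.

Lemma b0000_size (n : nat) : b [:: 0; 0; 0; 0] n.+1 = size (words n).
Proof.
apply: b_correct => [|w]; first exact: uniq_words.
by rewrite mem_words in_B0000E.
Qed.

Fixpoint paths (n : nat) (s : state) : nat :=
  if n is m.+1 then \sum_(t <- succ s) paths m t else 1.

Definition init : state := (1, 0, true, 0).

Lemma size_words (n : nat) : size (words n) = paths n init.
Proof.
(* Each word is weighted by its [k]-step continuations, so that the induction can pass a step from
   [n] to [k]. *)
suff sum_words k : \sum_(w <- words n) paths k (state_of w) = paths (k + n) init.
  by rewrite -[n in RHS]add0n -sum_words /= sum1_size.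
elim: n k => [|n IHn] k.
  rewrite big_seq1 addn0 /state_of /top big_seq1 /=.
  by rewrite (_ : asc _ = 0) //; apply/eqP; rewrite -leqn0 asc_le.
rewrite addnS -addSn -IHn big_allpairs_dep !big_seq.
apply: eq_bigr => w; rewrite mem_words => /andP[/eqP sz_w vw].
by rewrite -[paths _ _]/(\sum_(t <- succ (state_of w)) paths k t) -state_of_letters // -?size_eq0 ?sz_w // big_map.
Qed.

Local Open Scope ring_scope.

(** * Products and quotients of power series *)

(** Truncation does not affect low coefficients; the ring laws of polynomials thus carry over to
    series. *)
Lemma fps_mul_polyE (R : nzRingType) (f g : fps R) (N n : nat) :
  (n <= N)%N ->
  fps_mul f g n = (\poly_(i < N.+1) f i * \poly_(i < N.+1) g i)`_n.
Proof.
move=> leN; rewrite coefM; apply: eq_bigr => i _.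
by rewrite !coef_poly !ltnS (leq_trans (leq_subr _ _) leN)
  (leq_trans (leq_ord i) leN).
Qed.

Lemma fps_mulA (R : nzRingType) (f g h : fps R) :
  fps_mul f (fps_mul g h) =1 fps_mul (fps_mul f g) h.
Proof.
move=> n; pose t (u : fps R) := \poly_(i < n.+1) u i.
transitivity ((t f * (t g * t h))`_n).
  rewrite coefM; apply: eq_bigr => i _.
  by rewrite -fps_mul_polyE ?leq_subr // coef_poly ltnS leq_ord.
rewrite mulrA coefM; apply: eq_bigr => i _.
by rewrite -fps_mul_polyE ?leq_ord // coef_poly ltnS leq_subr.
Qed.

Lemma fps_mulC (R : comNzRingType) (f g : fps R) : fps_mul f g =1 fps_mul g f.
Proof. by move=> n; rewrite !(fps_mul_polyE _ _ (leqnn n)) mulrC. Qed.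

Lemma fps_mul1 (R : nzRingType) (f : fps R) :
  fps_mul f (fps_of_poly 1) =1 f.
Proof.
move=> n; rewrite /fps_mul big_ord_recr /= subnn /fps_of_poly coef1 mulr1.
rewrite big1 ?add0r // => i _.
by rewrite coef1 subn_eq0 leqNgt ltn_ord mulr0.
Qed.

Lemma eq_fps_mul (R : nzRingType) (f f' g g' : fps R) :
  f =1 f' -> g =1 g' -> fps_mul f g =1 fps_mul f' g'.
Proof. by move=> ff gg n; apply: eq_bigr => i _; rewrite ff gg. Qed.

(** Identifies a quotient by clearing the denominator: [h = h * (g * g^-1) = f * g^-1]. *)
Lemma fps_divE (R : comUnitRingType) (f g h : fps R) :
  g 0 \is a GRing.unit -> fps_mul g h =1 f -> h =1 fps_div f g.
Proof.
move=> ug gh n; rewrite /fps_div -(eq_fps_mul gh (fun=> erefl)).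
rewrite -(eq_fps_mul (fps_mulC h g) (fun=> erefl)) -fps_mulA.
by rewrite (eq_fps_mul (fun=> erefl) (fps_mulfV ug)) fps_mul1.
Qed.

(** * Residues and their vanishing from rank 15 on *)

Definition num : seq int :=
  [:: 0; 1; -3; 0; 3; 11; -3; -19; -9; 11; 14; 11; 4; 1].

Definition den : seq int :=
  [:: 1; -5; 5; 5; 5; -21; -15; 5; 35; 25; -1; -25; -25; -15; -5; -1].

Lemma numE :
  'X * (1 - 3 * 'X + 3 * 'X^3 + 11 * 'X^4 - 3 * 'X^5 - 19 * 'X^6
        - 9 * 'X^7 + 11 * 'X^8 + 14 * 'X^9 + 11 * 'X^10
        + 4 * 'X^11 + 'X^12) = Poly num.
Proof. by rewrite /= !cons_poly_def; ring. Qed.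

Lemma denE : (1 - 'X - 'X^2 - 'X^3) ^+ 5 = Poly den.
Proof. by rewrite /= !cons_poly_def; ring. Qed.

Definition residue (s : state) : fps int :=
  fps_mul (nth 0 den) (fun n => (paths n s)%:Z).

Lemma residue0 (s : state) : residue s 0 = 1.
Proof. by rewrite /residue /fps_mul big_ord1. Qed.

(** The path series satisfy [P_s = 1 + x * sum_t P_t] over the successors [t] of [s]; multiply by
    [den] and compare coefficients. *)
Lemma residueS (s : state) (n : nat) :
  residue s n.+1 = den`_n.+1 + \sum_(t <- succ s) residue t n.
Proof.
rewrite /residue /fps_mul big_ord_recr /= subnn mulr1 addrC; congr (_ + _).
rewrite exchange_big /=; apply: eq_bigr => i _.
rewrite subSn ?leq_ord //= -mulr_sumr; congr (_ * _).
by rewrite (big_morph Posz PoszD erefl).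
Qed.

(* Each unit of [asc w - top w] was gained by repeating the maximum after a
   zero, and a final zero can gain one more: hence [d + l < z]. *)
Definition states : seq state :=
  [seq s : state <- [seq (zc, ld.1, ld.2)
            | zc <- [seq (z, c) | z <- iota 1 3, c <- iota 0 4],
              ld <- [seq (l, d) | l <- [:: false; true], d <- iota 0 3]]
  | let: (z, c, l, d) := s in ((c == 0) && (d == 0) || (d + l < z))%N].

(** The sum is a [foldr] because big operators are locked and would block [vm_compute]. *)
Definition next_residue (n : nat) (r : seq int) (s : state) : int :=
  den`_n + foldr +%R 0 [seq r`_(index t states) | t <- succ s].

Fixpoint table (n : nat) : seq int :=
  if n is m.+1 then let r := table m in map (next_residue n r) states
  else nseq (size states) 1.

Lemma states_closed (s t : state) : s \in states -> t \in succ s -> t \in states.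
Proof.
have /allP closed : all (fun s => all (mem states) (succ s)) states by vm_compute.
by move=> /closed/allP; apply.
Qed.

Lemma residue_table (n : nat) (s : state) :
  s \in states -> residue s n = (table n)`_(index s states).
Proof.
elim: n s => [|n IHn] s ss.
  by rewrite residue0 nth_nseq index_mem ss.
have -> : table n.+1 = map (next_residue n.+1 (table n)) states by [].
rewrite residueS (nth_map s) ?index_mem // nth_index //.
congr (_ + _); rewrite foldrE big_map !big_seq; apply: eq_bigr => t ts.
by rewrite IHn // (states_closed ss ts).
Qed.

Lemma residue_eq0 (n : nat) (s : state) :
  s \in states -> (15 <= n)%N -> residue s n = 0.
Proof.
move=> ss len; rewrite -(subnKC len); elim: (n - 15)%N s ss => [|k IHk] s ss.
  rewrite addn0 residue_table // (_ : table 15 = nseq (size states) 0) ?nth_nseq.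
    by case: ifP.
  by vm_compute.
(* [den] has 16 entries, so beyond index 15 it returns the default 0. *)
rewrite addnS residueS nth_default ?leq_addr // add0r big_seq big1 // => t ts.
exact/IHk/(states_closed ss ts).
Qed.

(** The shift reflects that [n] steps from [init] spell a word of length [n.+1]. Ranks below 15 are
    read off the table; beyond, both sides are 0. *)
Lemma residue_init (n : nat) : residue init n = num`_n.+1.
Proof.
have init_states : init \in states by vm_compute.
have [len|ltn] := leqP 15 n.
  by rewrite residue_eq0 // nth_default //; apply: leq_trans (leqW len).
rewrite residue_table //.
have /allP num_table : all (fun n => (table n)`_(index init states) == num`_n.+1)
  (iota 0 15) by vm_compute.
by apply/eqP/num_table; rewrite mem_iota.
Qed.

(** * The empty word and the generating function *)

Lemma b0000_empty : b [:: 0; 0; 0; 0]%N 0 = 1%N.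
Proof.
apply: (@b_correct _ _ [:: [::]]) => // w; rewrite in_B0000E inE size_eq0.
case: eqP => //= ->; rewrite /valid /= andbT.
by apply/esym/forallP => -[].
Qed.

Theorem theorem3p1 :
  f_ogf [:: 0; 0; 0; 0]%N =1
  fps_add (fps_of_poly 1)
    (fps_div
      (fps_of_poly
        ('X * (1 - 3 * 'X + 3 * 'X^3 + 11 * 'X^4 - 3 * 'X^5 - 19 * 'X^6
               - 9 * 'X^7 + 11 * 'X^8 + 14 * 'X^9 + 11 * 'X^10
               + 4 * 'X^11 + 'X^12)))
      (fps_of_poly ((1 - 'X - 'X^2 - 'X^3) ^+ 5))).
Proof.
(* The series of the nonempty words, which must equal the fraction; the empty word is the separate
   summand 1. *)
pose a n := if n is m.+1 then (paths m init)%:Z else 0.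
move=> n; rewrite /fps_add numE denE -(fps_divE (h := a)).
- rewrite /f_ogf /fps_of_poly coef1; case: n => [|n]; first by rewrite b0000_empty.
  by rewrite b0000_size size_words add0r.
- by rewrite /fps_of_poly coef_Poly unitr1.
move=> {n} [|n]; rewrite /fps_of_poly coef_Poly.
  by rewrite /fps_mul big_ord1 mulr0.
rewrite -residue_init /fps_mul; under eq_bigr do rewrite coef_Poly.
(* The last term of the convolution meets [a 0 = 0]; the others form the residue at rank [n]. *)
rewrite big_ord_recr /= subnn mulr0 addr0.
by apply: eq_bigr => i _; rewrite subSn ?leq_ord.
Qed.
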